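(* Suppose $f:2^\Omega\to\mathbb{R}_+$ is monotone and submodular. Then for any finite $O\subset\Omega$ and any $A\in\mathbb{R}_+^\Omega$, $$f(O)\le\widehat f(A)+\sum_{v\in O}\widehat f(v|A).$$
   Context: $\Omega$ is a finite ground set. For $A\in\mathbb{R}_+^\Omega$ (identified in the paper with the ''valid'' subset $\{(u,t):u\in\Omega,\ 0<t\le A_u\}$ of $\Omega\times\mathbb{R}_+$), $\mathsf{R}(A)\subseteq\Omega$ is the random set that includes each $u\in\Omega$ independently with probability $1-e^{-A_u}$, and $\widehat f(A):=\mathbf{E}[f(\mathsf{R}(A))]$. For $u\in\Omega$, the marginal value is $\widehat f(u|A):=\lim_{t\to0^+}\frac{\widehat f(A\oplus(u,[t]))-\widehat f(A)}{t}$, where $A\oplus(u,[t])$ is the vector obtained from $A$ by increasing coordinate $u$ by $t$. *)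

(* Defs.v *)
From mathcomp Require Import all_boot all_order all_algebra.
From mathcomp Require Import all_classical all_reals all_analysis.
Set Implicit Arguments.
Unset Strict Implicit.
Unset Printing Implicit Defensive.
Import Order.TTheory GRing.Theory Num.Theory.
Import numFieldNormedType.Exports.
Local Open Scope classical_set_scope.
Local Open Scope ring_scope.

Definition set_monotone (Omega : finType) (R : realType)
    (f : {set Omega} -> R) : Prop :=
  forall S T : {set Omega}, S \subset T -> f S <= f T.

Definition submodular (Omega : finType) (R : realType)
    (f : {set Omega} -> R) : Prop :=
  forall S T : {set Omega}, f (S :|: T) + f (S :&: T) <= f S + f T.

Definition randset_pmf (Omega : finType) (R : realType) (A : Omega -> R)
    (S : {set Omega}) : R :=
  \prod_(u : Omega) (if u \in S then 1 - expR (- A u) else expR (- A u)).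

Lemma sum_randset_pmf (Omega : finType) (R : realType) (A : Omega -> R) :
  \sum_(S : {set Omega}) randset_pmf A S = 1.
Proof.
rewrite -(bigA_distr _ _ (fun u => 1 - expR (- A u)) (fun u => expR (- A u))).
by rewrite big1//= => u _; rewrite subrK.
Qed.

Lemma randset_pmf_ge0 (Omega : finType) (R : realType) (A : Omega -> R)
    (S : {set Omega}) : (forall u, 0 <= A u) -> 0 <= randset_pmf A S.
Proof.
move=> A0; apply: prodr_ge0 => u _; case: ifP => _; last exact: expR_ge0.
by rewrite subr_ge0 -expR0 ler_expR oppr_le0.
Qed.

(* The inclusion events are independent, with probabilities 1 - e^(-A u). *)
Lemma randset_pmf_indep (Omega : finType) (R : realType) (A : Omega -> R)
    (W : {set Omega}) :
  \sum_(S : {set Omega} | W \subset S) randset_pmf A S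
  = \prod_(u in W) (1 - expR (- A u)).
Proof.
pose G u := if u \in W then 0 else expR (- A u).
transitivity (\prod_(u : Omega) ((1 - expR (- A u)) + G u)); last first.
  rewrite [RHS]big_mkcond; apply: eq_bigr => u _; rewrite /G.
  by case: ifP => _; rewrite ?addr0 ?subrK.
rewrite bigA_distr big_mkcond; apply: eq_bigr => S _.
case: ifPn => [WS|/subsetPn[u uW uS]].
  apply: eq_bigr => u _; case: ifPn => // uS; rewrite /G ifN//.
  by apply: contra uS => /(fintype.subsetP WS).
by rewrite (bigD1 u)//= (negbTE uS) /G uW mul0r.
Qed.

Definition fhat (Omega : finType) (R : realType) (f : {set Omega} -> R)
    (A : Omega -> R) : R :=
  \sum_(S : {set Omega}) randset_pmf A S * f S.

Definition incr (Omega : finType) (R : realType) (A : Omega -> R)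
    (u : Omega) (t : R) : Omega -> R :=
  fun v => if v == u then A v + t else A v.

Definition marginal (Omega : finType) (R : realType) (f : {set Omega} -> R)
    (u : Omega) (A : Omega -> R) : R :=
  lim ((fhat f (incr A u t) - fhat f A) / t @[t --> 0^'+]).

(* Main.v *)
Require Import Defs.
From mathcomp Require Import all_boot all_order all_algebra.
From mathcomp Require Import all_classical all_reals all_analysis.
From mathcomp Require Import ring lra.
Import Order.TTheory GRing.Theory Num.Theory.
Import numFieldNormedType.Exports.
Local Open Scope ring_scope.

(* Increasing A by t at u amounts to adding u to the random set with an
   independent probability 1 - e^(-t).  Hence the marginal value at u is the
   expected gain of adding u to the random set, and the inequality is the
   expectation of f O <= f S + \sum_(v in O) (f (S + v) - f S). *)

(** Sets containing [u] are reindexed by deleting [u], so that a change of weight at coordinate [u]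
    can be checked pair by pair. *)
Lemma sum_set_pair (Omega : finType) (V : nmodType) (u : Omega)
    (F : {set Omega} -> V) :
  \sum_(S : {set Omega}) F S = \sum_(S : {set Omega} | u \notin S) (F S + F (u |: S)).
Proof.
rewrite (bigID (fun S : {set Omega} => u \notin S)) big_split /=.
congr (_ + _).
rewrite (reindex_onto (fun S => u |: S) (fun S => S :\ u)) /=.
  apply: eq_bigl => S; rewrite finset.setU11 /=.
  apply/eqP/idP => [<-|uS]; first by rewrite finset.setD11.
  exact: finset.setU1K.
by move=> S; rewrite negbK => uS; rewrite finset.setD1K.
Qed.

Lemma fhat_incr (Omega : finType) (R : realType) (f : {set Omega} -> R)
    (A : Omega -> R) (u : Omega) (t : R) :
  fhat f (incr A u t) =
  \sum_(S : {set Omega}) randset_pmf A S *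
    (expR (- t) * f S + (1 - expR (- t)) * f (u |: S)).
Proof.
rewrite /fhat !(sum_set_pair _ _ u); apply: eq_bigr => S uS.
rewrite finset.setUA finset.setUid.
(* [P] collects the coordinates other than [u]: it is the same for [S] and [u |: S], and for [A] and
   [incr A u t]. *)
set P := \prod_(v | v != u) (if v \in S then 1 - expR (- A v) else expR (- A v)).
have pmfE B (T : {set Omega}) : (forall v, v != u -> B v = A v) ->
    (forall v, v != u -> (v \in T) = (v \in S)) ->
    randset_pmf B T = (if u \in T then 1 - expR (- B u) else expR (- B u)) * P.
  move=> BA TS; rewrite /randset_pmf (bigD1 u) //=; congr (_ * _).
  by apply: eq_bigr => v vu; rewrite BA ?TS.
have uSE v : v != u -> (v \in u |: S) = (v \in S) by rewrite !inE => /negbTE ->.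
have iE v : v != u -> incr A u t v = A v by rewrite /incr => /negbTE ->.
(* With a = [A u], what remains is 1 - e^(-a-t) = (1 - e^(-a)) + e^(-a) (1 - e^(-t)). *)
rewrite !pmfE // finset.setU11 (negbTE uS) /incr eqxx opprD expRD; ring.
Qed.

(** This is the difference quotient at 0 of t |-> -e^(-t), whose derivative there is 1. *)
Lemma cvg_one_sub_expRN_div (R : realType) :
  ((1 - expR (- t)) / t @[t --> (0 : R)^'+] --> (1 : R))%classic.
Proof.
have [dF DF] : is_derive (0 : R) (1 : R) (fun t : R => - expR (- t)) 1.
  by apply: is_derive_eq; rewrite oppr0 expR0 mul1r opprK.
apply: cvg_dnbhs_at_right; rewrite -[X in (_ --> X)%classic]DF.
apply: cvg_trans dF; apply: near_eq_cvg; apply: nearW => t /=.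
by rewrite [t *: _]mulr1 addr0 oppr0 expR0 opprK addrC [LHS]mulrC.
Qed.

(** By [fhat_incr] the quotient equals (1 - e^(-t)) / t times the right-hand side for every t, so
    only this scalar factor has to converge. *)
Lemma marginalE (Omega : finType) (R : realType) (f : {set Omega} -> R)
    (u : Omega) (A : Omega -> R) :
  marginal f u A =
  \sum_(S : {set Omega}) randset_pmf A S * (f (u |: S) - f S).
Proof.
rewrite /marginal; set m := RHS.
have -> : (fun t => (fhat f (incr A u t) - fhat f A) / t) =
          (fun t => (1 - expR (- t)) / t * m).
  apply/funext => t; rewrite mulrAC; congr (_ / _).
  rewrite fhat_incr /fhat -sumrB mulr_sumr.
  by apply: eq_bigr => S _; ring.
apply: cvg_lim => //; rewrite -[X in (_ --> X)%classic]mul1r.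
by apply: cvgMl; exact: cvg_one_sub_expRN_div.
Qed.

Lemma submodular_le_sum_gains (Omega : finType) (R : realType)
    (f : {set Omega} -> R) (O S : {set Omega}) :
  set_monotone f -> submodular f ->
  f O <= f S + \sum_(v in O) (f (v |: S) - f S).
Proof.
(* Passing to [S :|: O] allows induction on the size of [O], adding its elements to [S] one at a
   time. *)
move=> f_mono f_submod; apply: (le_trans (f_mono O (S :|: O) (finset.subsetUr _ _))).
have [n] := ubnP #|O|; elim: n O => // n IHn O; rewrite ltnS => On.
have [->|[x xO]] := set_0Vmem O; first by rewrite finset.setU0 big_set0 addr0.
rewrite (big_setD1 x) //=.
have {}IHn : f (S :|: O :\ x) <= f S + \sum_(v in O :\ x) (f (v |: S) - f S).
  by apply: IHn; rewrite (leq_trans _ On) // [leqRHS](cardsD1 x) xO.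
(* The union of these two sets is [S :|: O] and their intersection contains [S], so adding [x] last
   gains at most [f (x |: S) - f S]. *)
have /= := f_submod (S :|: O :\ x) (x |: S).
have -> : (S :|: O :\ x) :|: (x |: S) = S :|: O.
  apply/setP => y; rewrite !inE; case: eqP => [->|_]; rewrite ?xO ?orbT //=.
  by rewrite orbAC orbb.
have : f S <= f ((S :|: O :\ x) :&: (x |: S)).
  by apply: f_mono; rewrite finset.subsetI finset.subsetUl finset.subsetUr.
lra.
Qed.

Theorem lemma4p5 (R : realType) (Omega : finType) (f : {set Omega} -> R)
    (f_ge0 : forall S : {set Omega}, 0 <= f S)
    (f_mono : set_monotone f) (f_submod : submodular f)
    (O : {set Omega}) (A : Omega -> R) (A_ge0 : forall u : Omega, 0 <= A u) :
  f O <= fhat f A + \sum_(v in O) marginal f v A.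
Proof.
under eq_bigr do rewrite marginalE.
rewrite exchange_big /= /fhat -big_split /=.
(* The weights sum to 1, so [f O] is its own expectation and the bound can be proved for each [S]
   separately. *)
rewrite -[f O]mul1r -(sum_randset_pmf A) mulr_suml; apply: ler_sum => S _.
rewrite -mulr_sumr -mulrDr ler_wpM2l ?randset_pmf_ge0 //.
exact: submodular_le_sum_gains.
Qed.
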